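(* Let $k\ge2$ and $n\ge1$. If $\gamma^{(1)},\ldots,\gamma^{(k)},\delta^{(1)},\ldots,\delta^{(k)}$ are compositions of $n$ such that $\ell(\gamma^{(t)})=\ell(\delta^{(t)})$ for all $t\in[k]$ (where $\ell$ denotes the length), then the sets $\mathcal{T}_{\gamma^{(1)},\ldots,\gamma^{(k)}}$ and $\mathcal{T}_{\delta^{(1)},\ldots,\delta^{(k)}}$ are in bijection, where $\mathcal{T}_{\gamma^{(1)},\ldots,\gamma^{(k)}}$ denotes the set of vertex-labelled tree-rooted $k$-constellations of vertex-compositions $(\gamma^{(1)},\ldots,\gamma^{(k)})$.
   Context: $[m]=\{1,\ldots,m\}$. A composition of $n$ is a finite sequence of positive integers with sum $n$; its length is its number of parts. A map is a cellular embedding (all faces simply connected) of a connected graph (loops and multiple edges allowed) in an oriented compact connected surface without boundary, considered up to orientation preserving homeomorphism. A $k$-constellation is a map with black and white faces and with vertices of types $1,\ldots,k$ (types taken modulo $k$) such that (i) each edge separates a black face and a white face, and (ii) each black face has degree $k$ and is incident to vertices of type $1,2,\ldots,k$ in this order clockwise around the face. Black faces are called hyperedges; the size is the number of hyperedges. An edge has type $t\in[k]$ if, clockwise around its incident hyperedge, it goes from a vertex of type $t$ to a vertex of type $t+1$; thus each hyperedge is incident to exactly one vertex and one edge of each type. Standard combinatorial encoding: $k$-constellations with hyperedges labelled by $[n]$ correspond bijectively to tuples $(\pi_1,\ldots,\pi_k)$ of permutations of $[n]$ generating a transitive group, the cycles of $\pi_t$ being the counterclockwise orders of the hyperedges around the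 vertices of type $t$. A constellation is rooted if one hyperedge is distinguished (root hyperedge); its root vertex is the vertex of type $k$ incident to the root hyperedge. The hyperdegree of a vertex is the number of incident hyperedges. A constellation with $p_t$ vertices of type $t$ for each $t$ is vertex-labelled if for each $t\in[k]$ its $p_t$ vertices of type $t$ have distinct labels in $[p_t]$; a vertex-labelled constellation of size $n$ has vertex-compositions $(\gamma^{(1)},\ldots,\gamma^{(k)})$ if, for all $t$, $\gamma^{(t)}$ is the composition of $n$ of length $p_t$ whose $i$th part is the hyperdegree of the vertex of type $t$ labelled $i$. For a vertex $v_0$ of a constellation $C$, a $v_0$-arborescence of $C$ is a spanning tree $A$ of (the underlying graph of) $C$ such that every vertex $v\ne v_0$ of type $t$ is incident to exactly one edge of type $t$ in $A$. A tree-rooted constellation is a pair $(C,A)$ where $C$ is a rooted constellation and $A$ is a $v_0$-arborescence of $C$, with $v_0$ the root vertex of $C$. *)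

(* Defs.v *)
From HB Require Import structures.
From mathcomp Require Import all_boot all_fingroup.

Set Implicit Arguments.
Unset Strict Implicit.
Unset Printing Implicit Defensive.

Definition is_composition (n : nat) (s : seq nat) : bool :=
  all (fun m => 0 < m) s && (sumn s == n).

(* Hyperedges are labelled by 'I_n, and i : 'I_k stands for the type i+1; the
   successor of a type modulo k is ordS.  A k-constellation is the tuple of
   permutations whose cycles are the counterclockwise orders of the hyperedges
   around the vertices of each type. *)
Section Constellation.
Variables k n : nat.
Implicit Types (pi : {ffun 'I_k -> 'S_n}) (A : {set 'I_k * 'I_n}).

Definition is_constellation pi : bool :=
  [transitive <<[set pi t | t : 'I_k]>>%g, on [set: 'I_n] | 'P].

(* A vertex is a pair (type, set of incident hyperedges). *)
Definition vertices pi : {set 'I_k * {set 'I_n}} :=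
  [set v | v.2 \in porbits (pi v.1)].

Definition vertex_at pi (t : 'I_k) (h : 'I_n) : 'I_k * {set 'I_n} :=
  (t, porbit (pi t) h).

Definition hyperdegree (v : 'I_k * {set 'I_n}) : nat := #|v.2|.

(* The pair (t, h) is the edge of type t of the hyperedge h.  An edge is on the
   boundary of exactly one hyperedge, so each edge arises exactly once. *)
Definition edge_src pi (e : 'I_k * 'I_n) := vertex_at pi e.1 e.2.
Definition edge_dst pi (e : 'I_k * 'I_n) := vertex_at pi (ordS e.1) e.2.

Definition incident pi (e : 'I_k * 'I_n) (v : 'I_k * {set 'I_n}) : bool :=
  (v == edge_src pi e) || (v == edge_dst pi e).

(* Edges traversed in either direction: false is from source to target. *)
Definition dart_from pi (d : 'I_k * 'I_n * bool) :=
  if d.2 then edge_dst pi d.1 else edge_src pi d.1.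
Definition dart_to pi (d : 'I_k * 'I_n * bool) :=
  if d.2 then edge_src pi d.1 else edge_dst pi d.1.

Definition adjacent pi A : rel ('I_k * {set 'I_n}) := fun u v =>
  [exists d, [&& d.1 \in A, dart_from pi d == u & dart_to pi d == v]].

Definition connected_spanning pi A : bool :=
  [forall u in vertices pi, forall v in vertices pi,
     connect (adjacent pi A) u v].

(* Distinctness of the edges is not implied by that of the vertices: it rules
   out going back and forth along an edge, while two parallel edges do form a
   cycle. *)
Definition is_cycle pi A (s : seq ('I_k * 'I_n * bool)) : bool :=
  [&& s != [::],
      all (fun d => d.1 \in A) s,
      path.cycle (fun d d' => dart_to pi d == dart_from pi d') s,
      uniq [seq d.1 | d <- s] &
      uniq [seq dart_from pi d | d <- s]].

(* The bound on the length m loses nothing since edges are not repeated. *)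
Definition acyclic pi A : bool :=
  [forall m : 'I_#|A|.+1, forall s : m.-tuple ('I_k * 'I_n * bool),
     ~~ is_cycle pi A s].

Definition is_spanning_tree pi A : bool :=
  connected_spanning pi A && acyclic pi A.

Definition is_arborescence pi (v0 : 'I_k * {set 'I_n}) A : bool :=
  is_spanning_tree pi A &&
  [forall v in vertices pi, (v != v0) ==>
     (#|[set e in A | (e.1 == v.1) && incident pi e v]| == 1)].

(* The root vertex has type k, that is, index k - 1. *)
Definition is_root_arborescence pi (r : 'I_n) A : bool :=
  [exists t : 'I_k, (t.+1 == k) && is_arborescence pi (vertex_at pi t r) A].

End Constellation.

(* Data of a vertex-labelled tree-rooted constellation with labelled hyperedges;
   vlab t i is the set of hyperedges incident to the vertex
   of type t with label i.  The conditions relating the fields are those of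
   is_vltr below. *)
Record vltr_data (k n : nat) (p : 'I_k -> nat) := VltrData {
  perms : {ffun 'I_k -> 'S_n};
  root_hyperedge : 'I_n;
  vlab : {dffun forall t : 'I_k, {ffun 'I_(p t) -> {set 'I_n}}};
  arborescence : {set 'I_k * 'I_n} }.

Section VltrDataFinite.
Variables (k n : nat) (p : 'I_k -> nat).

Definition vltr_code (x : vltr_data n p) :=
  (perms x, root_hyperedge x, vlab x, arborescence x).
Definition vltr_decode c : vltr_data n p :=
  VltrData c.1.1.1 c.1.1.2 c.1.2 c.2.
Lemma vltr_codeK : cancel vltr_code vltr_decode.
Proof. by case. Qed.

HB.instance Definition _ := Finite.copy (vltr_data n p) (can_type vltr_codeK).
End VltrDataFinite.

Section TreeRooted.
Variables k n : nat.

Definition is_vertex_labelling (p : 'I_k -> nat) (x : vltr_data n p) : bool :=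
  [forall t, injectiveb (vlab x t) &&
             ([set vlab x t i | i : 'I_(p t)] == porbits (perms x t))].

Definition is_vltr (p : 'I_k -> nat) (x : vltr_data n p) : bool :=
  [&& is_constellation (perms x),
      is_vertex_labelling x &
      is_root_arborescence (perms x) (root_hyperedge x)
        (arborescence x)].

Definition has_vertex_compositions (gamma : 'I_k -> seq nat)
    (x : vltr_data n (fun t => size (gamma t))) : bool :=
  [forall t, forall i : 'I_(size (gamma t)),
     hyperdegree (t, vlab x t i) == nth 0 (gamma t) i].

Definition relabel (p : 'I_k -> nat) (s : 'S_n) (x : vltr_data n p) :
    vltr_data n p :=
  VltrData [ffun t => (perms x t ^ s)%g]
           (s (root_hyperedge x))
           [ffun t => [ffun i => s @: vlab x t i]]
           [set (e.1, s e.2) | e in arborescence x].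

Definition iso_class (p : 'I_k -> nat) (x : vltr_data n p) :
    {set vltr_data n p} :=
  [set relabel s x | s : 'S_n].

(* Constellations are considered up to homeomorphism, so an element is an
   isomorphism class of structures with labelled hyperedges. *)
Definition tree_rooted_set (gamma : 'I_k -> seq nat) :
    {set {set vltr_data n (fun t => size (gamma t))}} :=
  [set iso_class x | x in [pred x | is_vltr x & has_vertex_compositions x]].

Definition tree_rooted (gamma : 'I_k -> seq nat) : finType :=
  {c | c \in tree_rooted_set gamma}.

End TreeRooted.

(* Main.v *)
Require Import Defs.
From HB Require Import structures.
From mathcomp Require Import all_boot all_fingroup.

(* Reading the hyperedges around each non-root vertex from the one carrying its
   outgoing tree edge, and around the root vertex from the root hyperedge, turns
   the hyperedges around the vertices of type t into a word, that is, a
   permutation w_t of [n] sending positions to hyperedges; the composition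
   gamma^(t) only enters by cutting the positions into blocks.  The arborescence
   condition says that, in the graph joining block i of type t to the block of
   type t+1 containing the first hyperedge of block i, every vertex leads to the
   root.  After renaming positions, the blocks of type t start at 0..p_t-1 for
   every composition of length p_t, so it suffices to count solutions
   (w_1,..,w_k,root) for two block structures with the same starts, which may
   even be taken to differ at a single non-start position, moved from block i to
   block j.  If a solution for one structure is not one for the other, the move
   has created a cycle through j; exchanging the first hyperedges of the blocks
   i and j (and their roles, if one of them is the root) repairs it, and this
   exchange is an involution. *)

Set Implicit Arguments.
Unset Strict Implicit.
Unset Printing Implicit Defensive.

(** * Counting and iteration on finite types *)

Lemma subset_leq_card_inj (T : finType) (f : T -> T) (A B : {set T}) :
  injective f -> (forall x, x \in A -> f x \in B) -> #|A| <= #|B|.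
Proof.
move=> f_inj fAB; rewrite -(card_imset A f_inj).
by apply/subset_leq_card/subsetP=> _ /imsetP[x /fAB fxB ->].
Qed.

Lemma eq_card_setD (T : finType) (A B : {set T}) :
  #|A :\: B| = #|B :\: A| -> #|A| = #|B|.
Proof. by move=> eAB; rewrite -(cardsID B A) eAB setIC cardsID. Qed.

Lemma card_bij (T U : finType) : #|T| = #|U| -> exists f : T -> U, bijective f.
Proof.
move=> eTU; exists (fun x => enum_val (cast_ord eTU (enum_rank x))).
exists (fun y => enum_val (cast_ord (esym eTU) (enum_rank y))) => x.
  by rewrite enum_valK cast_ordK enum_rankK.
by rewrite enum_valK cast_ordKV enum_rankK.
Qed.

Lemma uniq_map_inj (S T : eqType) (f : S -> T) (s : seq S) :
  uniq [seq f x | x <- s] -> {in s &, injective f}.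
Proof.
elim: s => //= z s IHs /andP[zs s_uniq] x y.
rewrite !inE => /predU1P[->|xs] /predU1P[->|ys] // e; last exact: IHs.
  by rewrite e map_f in zs.
by rewrite -e map_f in zs.
Qed.

(** The first value repeated along the orbit of [x] is some [iter a f x], and the tail of the orbit
    from there on is the cycle. *)
Lemma fcycle_reachable (T : finType) (f : T -> T) x :
  exists2 y, fconnect f x y &
    exists m, fcycle f (traject f y m.+1) && uniq (traject f y m.+1).
Proof.
have /trajectP[a lta xa] := looping_order f x.
exists (iter a f x); first exact: fconnect_iter.
exists (fingraph.order f x - a.+1); rewrite subnSK //; apply/andP; split; last first.
  have := orbit_uniq f x.
  by rewrite /fingraph.orbit -{1}(subnKC (ltnW lta)) trajectD cat_uniq => /and3P[].
rewrite -subnSK // [traject _ _ _]/=; set m := _ - _.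
have -> : path.cycle (frel f) (iter a f x :: traject f (f (iter a f x)) m)
    = fpath f (iter a f x) (traject f (f (iter a f x)) m.+1).
  rewrite trajectSr -iterSr -iterD /m addSnnS subnK // xa.
  by [].
exact: fpath_traject.
Qed.

(** * Trees given by a parent function *)

(* Locked, for otherwise conversion tests unfold [connect]. *)
HB.lock Definition reaches_all (X : finType) (f : X -> X) (r : X) : bool :=
  [forall x, fconnect f x r].

Lemma reaches_allP (X : finType) (f : X -> X) (r : X) :
  reflect (forall x, fconnect f x r) (reaches_all f r).
Proof. by rewrite reaches_all.unlock; apply: forallP. Qed.

Lemma eq_reaches_all (X : finType) (f g : X -> X) r :
  f =1 g -> reaches_all f r = reaches_all g r.
Proof.
move=> fg; rewrite reaches_all.unlock; apply: eq_forallb => x.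
exact/eq_connect/eq_frel.
Qed.

Section FunctionalTrees.
Variable X : finType.
Implicit Types (f g : X -> X) (r : X) (d : X -> nat).

(** The depth counts the iterations until [r] is first hit. Nothing is asked of [f r], so that
    [step] can be a total function. *)
Lemma reaches_all_depth f r : reaches_all f r ->
  exists2 d, d r = 0 & forall x, x != r -> d x = (d (f x)).+1.
Proof.
move/reaches_allP=> fr.
have ex_it x : exists m, iter m f x == r.
  by have /connectP[p /fpathP[m ->] ->] := fr x; exists m; rewrite last_traject.
exists (fun x => ex_minn (ex_it x)).
  by case: ex_minnP => m _ /(_ 0 (eqxx _)); rewrite leqn0 => /eqP.
move=> x x'r; case: ex_minnP => -[|m] /eqP em mmin; first by rewrite -em eqxx in x'r.
case: ex_minnP => m' /eqP em' m'min; apply/eqP; rewrite eqn_leq.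
by rewrite mmin ?iterSr ?em' // ltnS m'min // -iterSr em.
Qed.

Lemma depth_reaches_all f r d :
  (forall x, x != r -> d (f x) < d x) -> reaches_all f r.
Proof.
move=> dP; apply/reaches_allP=> x; have [m] := ubnP (d x).
elim: m x => // m IHm x ltm; have [->|x'r] := eqVneq x r; first exact: connect0.
apply: connect_trans (fconnect1 f x) (IHm _ _).
by apply: leq_trans (dP _ x'r) _.
Qed.

(* [f'] redirects [c] from [i] to [j]; [g] and [g'] arise from [f] and [f'] by
   exchanging the images of [i] and [j], up to permuting [i] and [j] among the
   values.  When the redirection closes a cycle, this cycle runs
   j -> .. -> c -> j, and the exchange opens it. *)
Lemma exchange_reaches_all f f' g g' (i j c r : X) :
    i != j -> c != i -> c != j -> f c = i ->
    (forall x, x != c -> f' x = f x) -> f' c = j ->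
    g i = f j -> (forall x, x != c -> g x = g' x) -> g c = i ->
    g' i = f j -> g' j = f i -> g' c = j ->
    (forall x, x != i -> x != j -> x != c ->
       g' x = f x \/ f x \in [:: i; j] /\ g' x \in [:: i; j]) ->
    reaches_all f r -> ~~ reaches_all f' r ->
  reaches_all g' (tperm i j r) && ~~ reaches_all g (tperm i j r).
Proof.
move=> i'j c'i c'j fc f'E f'c gi gE gc g'i g'j g'c g'E frT f'rF.
have [d dr dS] := reaches_all_depth frT.
(* If the root were [j] or [c], then [d] would still decrease under [f'] off the root: [c] would
   point to the root, or be the root. *)
have r'j : r != j.
  apply: contraNneq f'rF => rj; rewrite rj in dr dS *.
  apply: (@depth_reaches_all _ _ d) => x x'j; have [->|x'c] := eqVneq x c.
    by rewrite f'c dr dS.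
  by rewrite f'E // (dS x).
have r'c : r != c.
  apply: contraNneq f'rF => rc; rewrite rc in dr dS *.
  by apply: (@depth_reaches_all _ _ d) => x x'c; rewrite f'E // (dS x).
have d_gt0 x : (0 < d x) = (x != r).
  by have [->|/dS->] := eqVneq x r; rewrite ?dr.
have d_iter l x : l <= d x -> d (iter l f x) = d x - l.
  elim: l => [|l IHl] ltl; first by rewrite subn0.
  have := IHl (ltnW ltl); rewrite iterS => dl.
  have: iter l f x != r by rewrite -d_gt0 dl subn_gt0.
  by move/dS; rewrite dl => /esym/eqP; rewrite subnS => /eqP <-.
(* The path from [j] to the root meets [c]; otherwise it is also a path for [f'], and every point
   still reaches [r] under [f']. *)
have [l ltl jc]: exists2 l, l < d j & iter l f j = c.
  have [/existsP[l /eqP jc]|] := boolP [exists l : 'I_(d j), iter l f j == c].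
    by exists l.
  rewrite negb_exists => /forallP/= no_c; case/negP: f'rF.
  have itE l : l <= d j -> iter l f' j = iter l f j.
    elim: l => // l IHl ltl; rewrite !iterS IHl ?(ltnW ltl) // f'E //.
    exact: (no_c (Ordinal ltl)).
  have f'j : fconnect f' j r.
    have: d (iter (d j) f j) = 0 by rewrite (d_iter (d j)) ?subnn.
    move/eqP; rewrite -leqn0 leqNgt d_gt0 negbK => /eqP <-.
    by rewrite -itE // fconnect_iter.
  apply/reaches_allP=> x; have [m] := ubnP (d x); elim: m x => // m IHm x ltm.
  have [->|x'r] := eqVneq x r; first exact: connect0.
  apply: connect_trans (fconnect1 f' x) _.
  have [->|x'c] := eqVneq x c; first by rewrite f'c.
  by rewrite f'E // IHm //; move: ltm; rewrite (dS x).
have l_gt0 : 0 < l by case: l jc {ltl} => // jc; rewrite -jc eqxx in c'j.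
have dc : d c = d j - l by rewrite -jc (d_iter l) // ltnW.
have cr : c != r by rewrite eq_sym.
have di : d i = d j - l.+1 by move: (dS _ cr); rewrite fc dc subnS => ->.
have lt_ij : d i < d j by rewrite di ltn_subrL (leq_trans _ ltl).
(* By depth, the points after [j] up to [c] avoid [i] and [j], so [g'] will agree with [f] strictly
   between [j] and [c]. *)
have mid s : 0 < s <= l -> (iter s f j != i) && (iter s f j != j).
  case/andP=> s_gt0 les; have les' : s <= d j by apply: leq_trans les (ltnW ltl).
  have ds := d_iter s j les'; apply/andP; split.
    apply/eqP=> e; move: ds; rewrite e di => /eqP.
    by rewrite (eqn_sub2lE) // => /eqP e'; rewrite -e' ltnn in les.
  apply/eqP=> e; move: ds; rewrite e => /eqP; rewrite -{1}(subn0 (d j)).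
  by rewrite eqn_sub2lE // eq_sym => /eqP s0; rewrite s0 in s_gt0.
have midc s : 0 < s < l -> iter s f j != c.
  case/andP=> s_gt0 lts; apply/eqP=> e.
  have := d_iter s j (leq_trans (ltnW lts) (ltnW ltl)).
  rewrite e dc => /eqP; rewrite eqn_sub2lE ?(ltnW ltl) //.
    by move/eqP=> e'; rewrite e' ltnn in lts.
  by apply: leq_trans (ltnW lts) (ltnW ltl).
have g'_mid s : 0 < s < l -> g' (iter s f j) = iter s.+1 f j.
  move=> hs; have /andP[s_gt0 lts] := hs.
  have /andP[n_i n_j] : (iter s f j != i) && (iter s f j != j).
    by apply: (mid s); rewrite s_gt0 ltnW.
  have /andP[m_i m_j] : (iter s.+1 f j != i) && (iter s.+1 f j != j).
    exact: (mid s.+1).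
  have [->//|[]] := g'E _ n_i n_j (midc _ hs).
  by rewrite -(iterS s f j) !inE (negPf m_i) (negPf m_j).
have i_avoids s : 0 < s <= l -> fconnect g' (iter s f j) j.
  case/andP=> s_gt0 /subKn <-; have: l - s < l by rewrite ltn_subrL s_gt0.
  elim: (l - s) => [_|m IHm ltm].
    by rewrite subn0 jc -g'c fconnect1.
  apply: connect_trans (fconnect1 g' _) _.
  rewrite g'_mid ?subn_gt0 ?ltm ?ltn_subrL ?l_gt0 //.
  by rewrite -subSn ?subSS; [apply: IHm (ltnW ltm) | apply: ltnW].
have ij : fconnect g' i j.
  apply: connect_trans (fconnect1 g' i) _.
  by rewrite g'i; apply: (i_avoids 1); rewrite l_gt0.
(* Below the depth of [i] the values [i] and [j] cannot occur, so [g'] follows [f] down to [r]. *)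
have low : r != i -> forall y, d y < d i -> fconnect g' y r.
  move=> r'i y; have [m] := ubnP (d y); elim: m y => // m IHm y ltm lty.
  have [->|y'r] := eqVneq y r; first exact: connect0.
  apply: connect_trans (fconnect1 g' y) _.
  have ltfy : d (f y) < d y by rewrite (dS y).
  have y'i : y != i by apply: contraTneq lty => ->; rewrite ltnn.
  have y'j : y != j.
    by apply: contraTneq lty => ->; rewrite -leqNgt ltnW.
  have y'c : y != c.
    by apply: contraTneq lty => ->; rewrite dc di subnS -leqNgt leq_pred.
  have [->|[]] := g'E _ y'i y'j y'c.
    by apply: IHm; [apply: leq_trans ltfy ltm | apply: ltn_trans ltfy lty].
  rewrite !inE => /orP[]/eqP fy _; move: (ltn_trans ltfy lty); rewrite fy.
    by rewrite ltnn.
  by rewrite ltnNge ltnW.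
have jr : fconnect g' j (tperm i j r).
  have [->|r'i] := eqVneq r i; first by rewrite tpermL connect0.
  rewrite tpermD 1?eq_sym //; apply: connect_trans (fconnect1 g' j) _.
  by rewrite g'j low // (dS i) // eq_sym.
have ir := connect_trans ij jr.
apply/andP; split.
  (* A step of [g'] either lowers [d] or lands on [i] or [j], which reach the new root by [ir] and
     [jr]. *)
  apply/reaches_allP=> x; have [m] := ubnP (d x); elim: m x => // m IHm x ltm.
  have [->//|x'i] := eqVneq x i; have [->//|x'j] := eqVneq x j.
  have [xr|x'r] := eqVneq x r; first by rewrite -xr tpermD 1?eq_sym // connect0.
  apply: connect_trans (fconnect1 g' x) _.
  have [->|x'c] := eqVneq x c; first by rewrite g'c.
  have [->|[_]] := g'E _ x'i x'j x'c.
    by rewrite IHm //; move: ltm; rewrite (dS x).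
  by rewrite !inE => /orP[]/eqP ->.
(* Under [g] the points i -> f j -> .. -> c -> i form a cycle that misses the new root. *)
pose C := [pred y | (y == i) || [exists s : 'I_l.+1, (0 < s) && (y == iter s f j)]].
have memC s : 0 < s <= l -> iter s f j \in C.
  case/andP=> s_gt0 les; rewrite inE; apply/orP; right; apply/existsP.
  by exists (Ordinal (les : s < l.+1)); rewrite s_gt0 eqxx.
have gC y : y \in C -> g y \in C.
  rewrite inE => /predU1P[->|/existsP[[s /=]]].
    by rewrite gi; apply: (memC 1); rewrite l_gt0.
  rewrite ltnS => les /andP[s_gt0 /eqP->].
  move: les; rewrite leq_eqVlt => /predU1P[->|lts].
    by rewrite jc gc inE eqxx.
  have s_mid : 0 < s < l by rewrite s_gt0.
  by rewrite gE ?midc // g'_mid // memC.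
have r'C : tperm i j r \notin C.
  rewrite inE negb_or; have [ri|r'i] := eqVneq r i.
    rewrite ri tpermL eq_sym i'j; apply/existsP=> -[[s /= les] /andP[s_gt0 /eqP js]].
    by have := mid s; rewrite s_gt0 -js eqxx andbF; move=> /(_ les).
  rewrite tpermD 1?eq_sym // eq_sym r'i; apply/existsP=> -[[s /= les]].
  rewrite ltnS in les; case/andP=> s_gt0 /eqP rs.
  have := d_iter s j (leq_trans les (ltnW ltl)).
  rewrite -rs dr => /esym/eqP; rewrite subn_eq0 leqNgt.
  by rewrite (leq_ltn_trans les).
apply/negP=> /reaches_allP/(_ i)/iter_findex gir; case/negP: r'C; rewrite -gir.
by elim: (findex _ _ _) => [|m IHm]; rewrite ?iterS ?gC // inE eqxx.
Qed.
End FunctionalTrees.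

(** * Counting trees for a given block structure *)

Lemma ordS_neq k (t : 'I_k) : 2 <= k -> ordS t != t.
Proof.
move=> k_gt1; rewrite -val_eqE /=; have := ltn_ord t.
rewrite leq_eqVlt => /predU1P[e|/modn_small->]; last by rewrite gtn_eqF.
by rewrite e modnn -eqSS e ltn_eqF.
Qed.

Section BlockMaps.
Variables (k n : nat) (t0 : 'I_k).
Implicit Types (b : 'I_k -> 'I_n -> 'I_n) (w : {ffun 'I_k -> 'S_n}).
Implicit Types (x : 'I_k * 'I_n) (y : {ffun 'I_k -> 'S_n} * 'I_n).

(* Position [q] of type [t] holds the hyperedge [w t q] and lies in the block
   starting at [b t q]; a start stands for the vertex whose block it opens, and
   [step] sends it to its parent.  Non-start positions are harmless extra points
   since [step] only takes starts as values. *)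
Definition step b w x : 'I_k * 'I_n :=
  (ordS x.1, b (ordS x.1) ((w (ordS x.1))^-1%g (w x.1 x.2))).

(** Here [y.2] is a position of type [t0], not a hyperedge; the root hyperedge is the one it
    holds. *)
Definition rooted_tree b y : bool :=
  (b t0 y.2 == y.2) && reaches_all (step b y.1) (t0, y.2).

Definition idempotent_blocks b := forall t q, b t (b t q) = b t q.

(** The root position follows its hyperedge, so the root hyperedge [y.1 t0 y.2] is unchanged. *)
Definition exchange tau i j y : {ffun 'I_k -> 'S_n} * 'I_n :=
  ([ffun t => if t == tau then (tperm i j * y.1 t)%g else y.1 t],
   if t0 == tau then tperm i j y.2 else y.2).

Lemma exchangeK tau i j : involutive (exchange tau i j).
Proof.
case=> w r; rewrite /exchange /=; congr (_, _); last first.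
  by case: (t0 == tau); rewrite ?tpermK.
apply/ffunP=> t; rewrite !ffunE; case: (t == tau) => //.
by rewrite mulgA tperm2 mul1g.
Qed.

Hypothesis k_gt1 : 2 <= k.

Section OneChange.
Variables (b b' : 'I_k -> 'I_n -> 'I_n) (tau : 'I_k) (a i j : 'I_n).
Hypotheses (ba : b tau a = i) (b'a : b' tau a = j) (i'j : i != j).
Hypotheses (i'a : i != a) (j'a : j != a) (bi : b tau i = i) (bj : b tau j = j).
Hypothesis b'E : forall t q, (t, q) != (tau, a) -> b' t q = b t q.

(** This position holds the same hyperedge as position [a] of type [tau]; it is the only point whose
    parent depends on the block of [a]. *)
Let c w : 'I_k * 'I_n :=
  (ord_pred tau, (w (ord_pred tau))^-1%g (w tau a)).

Let step_c (bb : 'I_k -> 'I_n -> 'I_n) w : step bb w (c w) = (tau, bb tau a).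
Proof. by rewrite /step /c /= ord_predK permKV permK. Qed.

Let step_off_c w x : x != c w -> step b' w x = step b w x.
Proof.
case: x => t q x'c; congr (_, _); apply: b'E; apply: contraNneq x'c.
by rewrite /c => /= -[<- <-]; rewrite ordSK permKV permK.
Qed.

(** Swapping the hyperedges at [i] and [j] exchanges the parents of these starts and, at the
    preceding type, permutes [i] and [j] among the values. As [k_gt1] makes the two types differ,
    the effects do not mix and [exchange_reaches_all] applies. *)
Lemma exchange_rooted_tree y :
    rooted_tree b y && ~~ rooted_tree b' y ->
  rooted_tree b' (exchange tau i j y) && ~~ rooted_tree b (exchange tau i j y).
Proof.
case: y => w r; set y' := exchange _ _ _ _.
rewrite /rooted_tree /= => /andP[/andP[/eqP br tr_b]].
have b'_fix t q : b t q = q -> b' t q = q.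
  move=> bq; rewrite b'E //; apply/eqP=> -[et eq].
  by move: i'a; rewrite -ba -et -eq bq eqxx.
rewrite b'_fix // eqxx /= => tr_b'.
set r' := y'.2; set w' := y'.1.
have br' : b t0 r' = r'.
  rewrite /r' /=; have [et|//] := eqVneq t0 tau.
  by case: tpermP => [_|_|_ _] //; rewrite et.
have w'a : w' tau a = w tau a.
  by rewrite /w' ffunE eqxx permM tpermD.
have w'E t : t != tau -> w' t = w t by rewrite /w' ffunE => /negPf->.
have cw' : c w' = c w.
  by rewrite /c w'a w'E // -(inj_eq (can_inj (@ordSK k))) ord_predK eq_sym ordS_neq.
have tperm_r : tperm (tau, i) (tau, j) (t0, r) = (t0, r').
  rewrite /r' /=; have [->|n_t] := eqVneq t0 tau; last first.
    by rewrite tpermD // xpair_eqE eq_sym (negPf n_t).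
  case: (tpermP i j r) => [->|->|]; rewrite ?tpermL ?tpermR //.
  by move=> /eqP n1 /eqP n2; rewrite tpermD // xpair_eqE eqxx eq_sym.
have c_type q : c w != (tau, q).
  rewrite xpair_eqE negb_and -(inj_eq (can_inj (@ordSK k))) ord_predK.
  by rewrite eq_sym ordS_neq.
rewrite br' b'_fix // eqxx /= -!tperm_r.
have step_w' (bb : 'I_k -> 'I_n -> 'I_n) q :
    step bb w' (tau, q) = step bb w (tau, tperm i j q).
  by rewrite /step /= w'E ?ordS_neq // /w' ffunE eqxx permM.
apply: (@exchange_reaches_all _ (step b w) (step b' w) (step b w') (step b' w')
          _ _ (c w)) => //; rewrite ?step_c ?ba ?b'a //.
- by rewrite xpair_eqE eqxx.
- by move=> x; apply: step_off_c.
- by rewrite step_w' tpermL.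
- by move=> x; rewrite -cw' => /step_off_c->.
- by rewrite -cw' step_c ba.
- by rewrite step_w' tpermL step_off_c // eq_sym.
- by rewrite step_w' tpermR step_off_c // eq_sym.
- by rewrite -cw' step_c b'a.
move=> [t q] xi xj xc; rewrite step_off_c ?cw' //.
have [et|n_t] := eqVneq t tau.
  left; rewrite et step_w' tpermD //.
    by apply: contraNneq xi => ->; rewrite et.
  by apply: contraNneq xj => ->; rewrite et.
have [et|n_St] := eqVneq (ordS t) tau; last first.
  by left; rewrite /step /= !w'E.
(* At the type before [tau], only a point whose hyperedge sat exactly at position [i] or [j] changes
   its value. *)
rewrite /step /= (w'E _ n_t) et /w' ffunE eqxx invMg permM tpermV.
by case: tpermP => [->|->|]; [right|right|left] => //; rewrite ?bi ?bj !inE !eqxx ?orbT.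
Qed.
End OneChange.

Definition rooted_trees b := [set y | rooted_tree b y].

Lemma in_rooted_trees b y : (y \in rooted_trees b) = rooted_tree b y.
Proof. by rewrite inE. Qed.

(** The injective map [exchange] sends the trees lost by the change to trees gained by it. *)
Lemma card_rooted_trees_change_le b b' tau a :
    idempotent_blocks b -> idempotent_blocks b' ->
    (forall t q, (b t q == q) = (b' t q == q)) -> b tau a != b' tau a ->
    (forall t q, (t, q) != (tau, a) -> b' t q = b t q) ->
  #|rooted_trees b :\: rooted_trees b'| <= #|rooted_trees b' :\: rooted_trees b|.
Proof.
move=> b_id b'_id fixE b'b' b'E.
pose i := b tau a; pose j := b' tau a.
have bi : b tau i = i by rewrite b_id.
have bj : b tau j = j by apply/eqP; rewrite fixE b'_id.
have i'a : i != a.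
  by apply: contraNneq b'b' => ia; rewrite /i in ia; rewrite ia eq_sym -fixE ia.
have j'a : j != a.
  by apply: contraNneq b'b' => ja; rewrite /j in ja; rewrite ja fixE ja.
apply: (subset_leq_card_inj (inv_inj (@exchangeK tau i j))) => y.
move/setDP=> [yb yb']; rewrite in_rooted_trees in yb; rewrite in_rooted_trees in yb'.
have := @exchange_rooted_tree b b' tau a i j erefl erefl b'b' i'a j'a bi bj b'E y.
rewrite yb yb' => /(_ isT)/andP[y1 y2].
by apply/setDP; split; rewrite in_rooted_trees.
Qed.

Lemma card_rooted_trees_change b b' tau a :
    idempotent_blocks b -> idempotent_blocks b' ->
    (forall t q, (b t q == q) = (b' t q == q)) -> b tau a != b' tau a ->
    (forall t q, (t, q) != (tau, a) -> b' t q = b t q) ->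
  #|rooted_trees b| = #|rooted_trees b'|.
Proof.
move=> b_id b'_id fixE b'b' b'E.
apply/eq_card_setD/eqP; rewrite eqn_leq; apply/andP; split.
  exact: (@card_rooted_trees_change_le b b' tau a).
apply: (@card_rooted_trees_change_le b' b tau a) => //.
  by rewrite eq_sym.
by move=> t q /b'E.
Qed.

Lemma card_rooted_trees_eq b b' :
    idempotent_blocks b -> idempotent_blocks b' ->
    (forall t q, (b t q == q) = (b' t q == q)) ->
  #|rooted_trees b| = #|rooted_trees b'|.
Proof.
move=> + b'_id; have [m] := ubnP #|[pred x | b x.1 x.2 != b' x.1 x.2]|.
elim: m b => // m IHm b ltm b_id fixE.
have [[tau a] /= neq|b_b'] := pickP [pred x | b x.1 x.2 != b' x.1 x.2]; last first.
  have eqb t q : b t q = b' t q by have /= := b_b' (t, q) => /negbFE/eqP.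
  have stepE w : step b w =1 step b' w by move=> x; rewrite /step eqb.
  apply: eq_card => -[w r]; rewrite !in_rooted_trees /rooted_tree eqb /=.
  congr (_ && _); apply: eq_reaches_all => x; apply: stepE.
(* One disagreement is corrected; since [b] and [b'] have the same fixed points, [b1] stays
   idempotent with these fixed points. *)
pose b1 t q := if (t, q) == (tau, a) then b' tau a else b t q.
have b1a : b1 tau a = b' tau a by rewrite /b1 eqxx.
have fix1 t q : (b1 t q == q) = (b t q == q).
  by rewrite /b1; case: ((t, q) =P (tau, a)) => // -[-> ->]; rewrite fixE.
have b1_fix t q : b t q = q -> b1 t q = q by move/eqP; rewrite -fix1 => /eqP.
have b1_id : idempotent_blocks b1.
  move=> t q; apply: b1_fix; rewrite /b1; case: eqP => [[-> _]|_]; last exact: b_id.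
  by apply/eqP; rewrite fixE b'_id.
rewrite (card_rooted_trees_change (tau := tau) (a := a) b_id b1_id) //.
- apply: IHm => //; last by move=> t q; rewrite fix1.
  rewrite -ltnS; apply: leq_trans ltm; apply: proper_card; apply/properP; split.
    apply/subsetP=> -[t q]; rewrite !inE /= /b1.
    by case: ((t, q) =P (tau, a)) => // -[-> ->]; rewrite eqxx.
  by exists (tau, a); rewrite !inE /= ?b1a ?eqxx.
- by rewrite b1a.
by move=> t q /negPf tq; rewrite /b1 tq.
Qed.

End BlockMaps.

(** * Acyclic edge sets in a constellation *)

Section Graph.
Variables k n : nat.
Implicit Types (pi : {ffun 'I_k -> 'S_n}) (A : {set 'I_k * 'I_n}).

Lemma acyclicP pi A :
  reflect (forall s, ~~ is_cycle pi A s) (acyclic pi A).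
Proof.
apply: (iffP forallP) => [acy s|acy m]; last by apply/forallP=> s; apply: acy.
apply/negP=> cyc; have [_ /allP sA _ s_uniq _] := and5P cyc.
have ltsA : size s < #|A|.+1.
  rewrite ltnS cardE -(size_map fst) uniq_leq_size // => e /mapP[d /sA dA ->].
  by rewrite mem_enum.
by have /forallP/(_ (in_tuple s)) := acy (Ordinal ltsA); rewrite cyc.
Qed.

(** Following a chosen outgoing edge within the finite set [U] eventually closes up into a cycle of
    forward darts. *)
Lemma out_edges_not_acyclic pi A (U : {set 'I_k * {set 'I_n}}) v :
    v \in U ->
    {in U, forall u, exists e,
       [/\ e \in A, edge_src pi e = u & edge_dst pi e \in U]} ->
  ~~ acyclic pi A.
Proof.
move=> vU outU; have [e0 _] := outU v vU.
have /fin_all_exists[out outP] u : exists e, u \in U ->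
    [/\ e \in A, edge_src pi e = u & edge_dst pi e \in U].
  by have [/outU[e eP]|u'U] := boolP (u \in U); [exists e | exists e0].
pose f u := edge_dst pi (out u).
have fU u w : u \in U -> fconnect f u w -> w \in U.
  move=> uU /iter_findex <-; elim: (findex _ _ _) => //= m IHm.
  by have [] := outP _ IHm.
have [y vy [m /andP[cyc]]] := fcycle_reachable f v.
have yU := fU _ _ vU vy; set s := traject _ _ _ in cyc * => s_uniq.
have y_s : y \in s by apply: mem_head.
have sU : {subset s <= U}.
  by move=> u /trajectP[l _ ->]; apply: fU yU (fconnect_iter _ _ _).
have out_inj : {in s &, injective out}.
  move=> u1 u2 /sU u1U /sU u2U e.
  by have [_ <- _] := outP _ u1U; have [_ <- _] := outP _ u2U; rewrite e.
apply/acyclicP=> /(_ [seq (out u, false) | u <- s])/negP; apply; apply/and5P.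
rewrite -!map_comp; clearbody s; split.
- by case: (s) y_s.
- by apply/allP=> _ /mapP[u /sU uU ->] /=; have [] := outP _ uU.
- rewrite cycle_map; apply: (sub_in_cycle (P := mem s)) cyc; last by apply/allP.
  move=> u w _ /sU wU; rewrite /= /dart_from /dart_to /=.
  by have [_ -> _] := outP _ wU.
- by rewrite map_inj_in_uniq.
rewrite map_inj_in_uniq // => u1 u2 /sU u1U /sU u2U /=.
rewrite /dart_from /=.
by have [_ -> _] := outP _ u1U; have [_ -> _] := outP _ u2U.
Qed.

(* At a dart of a cycle whose origin has maximal depth, the cycle has to
   arrive and leave through the same edge. *)
Lemma depth_acyclic pi A (D : 'I_k * {set 'I_n} -> nat) :
    {in A, forall e, D (edge_dst pi e) < D (edge_src pi e)} ->
    {in A &, injective (edge_src pi)} ->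
  acyclic pi A.
Proof.
move=> D_lt src_inj; apply/acyclicP=> s; apply/negP.
case/and5P=> s_nil /allP sA cyc s_uniq _.
have [d0 d0s] : exists d0, d0 \in s.
  by case: s s_nil {sA cyc s_uniq} => // d0 s _; exists d0; apply: mem_head.
case: (arg_maxnP (P := [in s]) (fun d => D (dart_from pi d)) d0s) => d ds dmax.
have d's : prev s d \in s by rewrite mem_prev.
have next_s : next s d \in s by rewrite mem_next.
have nb : d.2 = false.
  apply/negP=> back; have := dmax _ next_s.
  rewrite /= -(eqP (next_cycle cyc ds)) /dart_to /dart_from back leqNgt.
  by rewrite D_lt ?sA.
have b' : (prev s d).2.
  apply/negPn/negP=> /negPf forw; have := dmax _ d's; rewrite /=.
  rewrite -(eqP (prev_cycle cyc ds)) /dart_to /dart_from forw leqNgt.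
  by rewrite D_lt ?sA.
have := prev_cycle cyc ds; rewrite /dart_to /dart_from b' nb => /eqP.
move/src_inj=> /(_ (sA _ d's) (sA _ ds)) /(uniq_map_inj s_uniq d's ds) e.
by rewrite e nb in b'.
Qed.

End Graph.

(** * Permutations with prescribed cycles *)

Lemma porbit_conj (T : finType) (s w : {perm T}) x :
  porbit (s ^ w)%g (w x) = w @: porbit s x.
Proof.
apply/setP=> y; apply/porbitP/imsetP=> [[m ->]|[_ /porbitP[m ->] ->]].
  by exists ((s ^+ m)%g x); rewrite ?mem_porbit // -conjXg permJ.
by exists m; rewrite -conjXg permJ.
Qed.

Lemma permX_mod_porbit (T : finType) (s : {perm T}) x m :
  (s ^+ m)%g x = (s ^+ (m %% #|porbit s x|))%g x.
Proof.
set c := #|_|; have sc : (s ^+ c)%g x = x by rewrite permX iter_porbit.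
rewrite {1}(divn_eq m c) expgD permM; suff -> : (s ^+ (m %/ c * c))%g x = x by [].
by elim: (m %/ c) => [|d IHd]; rewrite ?perm1 // mulSn expgD permM sc.
Qed.

Lemma permX_inj_porbit (T : finType) (s : {perm T}) x l m :
  l < #|porbit s x| -> m < #|porbit s x| -> (s ^+ l)%g x = (s ^+ m)%g x -> l = m.
Proof.
move=> ltl ltm; rewrite !permX => e.
apply/eqP; rewrite -(nth_uniq x _ _ (uniq_traject_porbit s x)) ?size_traject //.
by rewrite !nth_traject // e.
Qed.

(** The point [m] steps after a start along [rho] goes to the point [m] steps after the image of the
    start along [pi]. Equal cycle lengths make this commute with the rotations; starts sent to
    distinct cycles make it injective. *)
Lemma conj_perm_exists (T : finType) (rho pi : {perm T}) (b s : T -> T) :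
    (forall q, b (b q) = b q) ->
    (forall q q', (q' \in porbit rho q) = (b q' == b q)) ->
    (forall q, b q = q -> #|porbit rho q| = #|porbit pi (s q)|) ->
    (forall q q', b q = q -> b q' = q' -> s q' \in porbit pi (s q) -> q' = q) ->
  exists w : {perm T}, pi = (rho ^ w)%g /\ forall q, b q = q -> w q = s q.
Proof.
move=> b_id porbit_rho card_s s_sep.
have /fin_all_exists[m mP] q :
    exists m, m < #|porbit rho (b q)| /\ q = (rho ^+ m)%g (b q).
  have : q \in porbit rho (b q) by rewrite porbit_rho b_id.
  by rewrite porbit_traject => /trajectP[m ltm qm]; exists m; rewrite permX.
pose f q := (pi ^+ m q)%g (s (b q)).
have fX q l : b q = q -> f ((rho ^+ l)%g q) = (pi ^+ l)%g (s q).
  move=> bq; set q' := _ q; have bq' : b q' = q.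
    by have := mem_porbit rho l q; rewrite porbit_rho bq => /eqP.
  have [] := mP q'; rewrite bq' {2}/q' permX_mod_porbit => ltm.
  move/permX_inj_porbit=> em; rewrite /f bq' [RHS]permX_mod_porbit -card_s //.
  by rewrite em // ltn_mod (leq_ltn_trans _ ltm).
have f_inj : injective f.
  move=> q q' e; have f_orb u : f u \in porbit pi (s (b u)) by apply: mem_porbit.
  have bqq' : b q' = b q.
    apply: s_sep => //; rewrite -eq_porbit_mem.
    have := f_orb q; have := f_orb q'; rewrite -!eq_porbit_mem e => /eqP<- /eqP<-.
    exact: eqxx.
  have [ltm ->] := mP q; have [ltm' ->] := mP q'; rewrite bqq' in ltm' *.
  suff -> : m q = m q' by []; apply: (@permX_inj_porbit _ pi (s (b q))).
  - by rewrite -card_s.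
  - by rewrite -card_s.
  by move: e; rewrite /f bqq'.
exists (perm f_inj); split=> [|q bq]; last first.
  by have := fX q 0 bq; rewrite permE !expg0 !perm1.
apply/permP=> h; rewrite -[h](permKV (perm f_inj)); set q := _ h.
have [_ qE] := mP q.
by rewrite permJ !permE [in RHS]qE {1}qE -permM -expgSr !fX // expgSr permM.
Qed.

(** Each fibre of [b] is rotated along its enumeration. *)
Lemma perm_of_blocks (T : finType) (b : T -> T) :
  exists rho : {perm T}, forall q q', (q' \in porbit rho q) = (b q' == b q).
Proof.
pose L q := enum [pred q' | b q' == b q].
pose f q := next (L q) q.
have Lq q : q \in L q by rewrite mem_enum inE.
have b_f q : b (f q) = b q.
  by have := Lq q; rewrite -mem_next mem_enum inE => /eqP.
have eqL q q' : b q = b q' -> L q = L q' by move=> e; rewrite /L e.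
have f_inj : injective f.
  move=> q q' e; have bqq' : b q = b q' by rewrite -b_f e b_f.
  move: e; rewrite /f (eqL _ _ bqq'); apply: can_inj (prev_next _) _ _.
  exact: enum_uniq.
exists (perm f_inj) => q q'; apply/porbitP/eqP=> [[m ->]|bq].
  elim: m => [|m IHm]; first by rewrite perm1.
  by rewrite expgSr permM permE b_f.
have cyc : fcycle f (L q).
  apply: (sub_in_cycle (P := mem (L q))) (cycle_next (enum_uniq _)); last exact/allP.
  move=> u v; rewrite mem_enum inE => /eqP bu _ /= /eqP <-.
  by rewrite /f (eqL _ _ bu).
have : fconnect f q q' by rewrite (fconnect_cycle cyc) // mem_enum inE bq.
move/iter_findex=> <-; exists (findex f q q').
by rewrite permX; apply: eq_iter => u; rewrite permE.
Qed.

(** * Encoding of tree-rooted constellations *)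

Lemma eq_vertex_at k n (pi : {ffun 'I_k -> 'S_n}) t t' h h' :
  (vertex_at pi t h == vertex_at pi t' h') =
    (t == t') && (h \in porbit (pi t) h').
Proof.
by rewrite xpair_eqE; case: eqP => [->|//]; rewrite eq_porbit_mem.
Qed.

Lemma vertex_at_vertices k n (pi : {ffun 'I_k -> 'S_n}) t h :
  vertex_at pi t h \in vertices pi.
Proof. by rewrite inE; apply: imset_f. Qed.

Lemma verticesP k n (pi : {ffun 'I_k -> 'S_n}) v :
  reflect (exists h, v = vertex_at pi v.1 h) (v \in vertices pi).
Proof.
rewrite inE; apply: (iffP imsetP) => [[h _ vh]|[h ->]]; exists h => //.
by rewrite /vertex_at -vh -surjective_pairing.
Qed.

Section Encoding.
Variables (k n : nat) (p : 'I_k -> nat) (t0 : 'I_k).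
Variables (b : 'I_k -> 'I_n -> 'I_n) (rho : 'I_k -> 'S_n).
Variable start : forall t, 'I_(p t) -> 'I_n.
Hypothesis k_gt1 : 2 <= k.
Hypothesis b_id : idempotent_blocks b.
Hypothesis porbit_rho :
  forall t q q', (q' \in porbit (rho t) q) = (b t q' == b t q).
Hypothesis start_fix : forall t (i : 'I_(p t)), b t (start i) = start i.
Hypothesis start_onto : forall t q, exists i : 'I_(p t), start i = b t q.
Hypothesis start_inj : forall t, injective (@start t).
Implicit Types (w : {ffun 'I_k -> 'S_n}) (x : 'I_k * 'I_n).
Implicit Types (y : {ffun 'I_k -> 'S_n} * 'I_n).

Definition cperm w : {ffun 'I_k -> 'S_n} := [ffun t => (rho t ^ w t)%g].

(** The edge of type [t] at a hyperedge leaves the vertex of type [t] there, so an arborescence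
    selects one hyperedge at each non-root vertex; words are read so that it sits at the start. *)
Definition start_edges y : {set 'I_k * 'I_n} :=
  [set e | let q := (y.1 e.1)^-1%g e.2 in
           (b e.1 q == q) && ((e.1, q) != (t0, y.2))].

Definition vertex_of w x := vertex_at (cperm w) x.1 (w x.1 x.2).

Lemma porbit_cperm w t q q' :
  (w t q' \in porbit (cperm w t) (w t q)) = (b t q' == b t q).
Proof. by rewrite ffunE porbit_conj mem_imset ?porbit_rho //; apply: perm_inj. Qed.

Lemma eq_vertex_of w t q q' :
  (vertex_of w (t, q) == vertex_of w (t, q')) = (b t q == b t q').
Proof. by rewrite eq_vertex_at eqxx porbit_cperm. Qed.

Lemma vertex_of_inj w x x' : b x.1 x.2 = x.2 -> b x'.1 x'.2 = x'.2 ->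
  vertex_of w x = vertex_of w x' -> x = x'.
Proof.
case: x x' => [t q] [t' q'] /= bq bq' e; have [et _] := e.
by move: e; rewrite -et => /eqP; rewrite eq_vertex_of bq {1}et bq' => /eqP->.
Qed.

Lemma mem_start_edges y t q :
  ((t, y.1 t q) \in start_edges y) = (b t q == q) && ((t, q) != (t0, y.2)).
Proof. by rewrite inE /= permK. Qed.

Lemma start_edgesP y e : e \in start_edges y ->
  exists t q, [/\ b t q = q, (t, q) != (t0, y.2) & e = (t, y.1 t q)].
Proof.
case: e => t h; rewrite inE /= => /andP[/eqP bq q_r].
by exists t, ((y.1 t)^-1%g h); rewrite permKV.
Qed.

Lemma edge_dst_step w t q :
  edge_dst (cperm w) (t, w t q) = vertex_of w (step b w (t, q)).
Proof.
apply/eqP; rewrite /edge_dst eq_vertex_at eqxx /=.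
by rewrite -{1}[w t q](permKV (w (ordS t))) porbit_cperm b_id.
Qed.

Lemma step_fix w x : b (step b w x).1 (step b w x).2 = (step b w x).2.
Proof. exact: b_id. Qed.

Lemma vertices_of w v : v \in vertices (cperm w) ->
  exists t q, b t q = q /\ v = vertex_of w (t, q).
Proof.
case/verticesP=> h ->; set t := v.1; pose q := (w t)^-1%g h.
exists t, (b t q); split; first exact: b_id.
apply/eqP; rewrite /vertex_of /= eq_vertex_at eqxx /=.
by rewrite -{1}[h](permKV (w t)) porbit_cperm b_id.
Qed.

(** Each vertex that does not lead to the root has an outgoing edge in the set, ending at another
    such vertex or itself; this forces a cycle. *)
Lemma acyclic_rooted_tree y :
  b t0 y.2 = y.2 -> acyclic (cperm y.1) (start_edges y) -> rooted_tree t0 b y.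
Proof.
case: y => w r /= br; rewrite /rooted_tree /= br eqxx /=; apply: contraTT.
move=> no_reach; have [x0 x0r] : exists x, ~~ fconnect (step b w) x (t0, r).
  by apply/existsP; move: no_reach; rewrite reaches_all.unlock negb_forall.
pose U := [set vertex_of w x | x in [pred x | (b x.1 x.2 == x.2) &&
                                    ~~ fconnect (step b w) x (t0, r)]].
have step_r x : ~~ fconnect (step b w) x (t0, r) ->
    ~~ fconnect (step b w) (step b w x) (t0, r).
  by apply: contra; apply: connect_trans (fconnect1 _ _).
have step_U x : ~~ fconnect (step b w) x (t0, r) ->
    vertex_of w (step b w x) \in U.
  by move=> /step_r xr; apply: imset_f; rewrite inE step_fix eqxx.
(* The point [x0] may fail to be a start, but its image under [step] is one. *)
apply: (out_edges_not_acyclic (step_U _ x0r)) => u.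
case/imsetP=> -[t q]; rewrite inE /= => /andP[bq qr] ->.
exists (t, w t q); split=> //; last by rewrite edge_dst_step step_U.
rewrite (mem_start_edges (w, r)) bq /=.
by apply: contraNneq qr => ->; apply: connect0.
Qed.

Lemma incident_src y t q v : v.1 = t ->
  incident (cperm y.1) (t, y.1 t q) v = (v == vertex_of y.1 (t, q)).
Proof.
move=> vt; rewrite /incident [v == edge_dst _ _](_ : _ = false) ?orbF //.
by apply/eqP=> e; move: vt; rewrite e => /eqP; rewrite (negPf (ordS_neq _ k_gt1)).
Qed.

Lemma rooted_tree_arborescence y : rooted_tree t0 b y ->
  is_arborescence (cperm y.1) (vertex_of y.1 (t0, y.2)) (start_edges y).
Proof.
case: y => w r /andP[/= /eqP br tr]; have [d d0 dS] := reaches_all_depth tr.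
set A := start_edges _; set pi := cperm w.
apply/andP; split; last first.
  apply/forall_inP=> v /vertices_of[t [q [bq ->]]]; apply/implyP=> v'r.
  rewrite -(cards1 (t, w t q)); apply/eqP/eq_card=> e; rewrite in_set in_set1.
  apply/andP/eqP=> [[/start_edgesP[t' [q' [bq' q'r ->]]] /andP[/= /eqP et]]|->].
    rewrite et in bq' q'r *; rewrite (incident_src (w, r)) // eq_vertex_of bq bq'.
    by move/eqP->.
  rewrite (mem_start_edges (w, r)) bq !eqxx (incident_src (w, r)) // eqxx.
  by split=> //; apply: contraNneq v'r => ->.
apply/andP; split.
  have adj_sym : symmetric (adjacent pi A).
    by move=> u v; apply/existsP/existsP=> -[[e c] /and3P[/= eA fr to]];
       exists (e, ~~ c); rewrite eA; case: c fr to => /= fr to;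
       rewrite /dart_from /dart_to /= in fr to *; rewrite fr to.
  have to_root v : v \in vertices pi -> connect (adjacent pi A) v (vertex_of w (t0, r)).
    case/vertices_of=> t0' [q0 [bq0 ->]].
    have: b (t0', q0).1 (t0', q0).2 = (t0', q0).2 by [].
    move: (t0', q0) => x {t0' q0 bq0 v}.
    have [m] := ubnP (d x); elim: m x => // m IHm [t q] ltm /= bq.
    have [->|x'r] := eqVneq (t, q) (t0, r); first exact: connect0.
    apply: (@connect_trans _ _ (vertex_of w (step b w (t, q)))); last first.
      by apply: IHm; rewrite ?step_fix //; move: ltm; rewrite (dS (t, q)).
    apply/connect1/existsP; exists ((t, w t q), false); apply/and3P; split=> //.
      by rewrite (mem_start_edges (w, r)) bq eqxx.
    by rewrite /dart_to /= edge_dst_step.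
  apply/forall_inP=> u /to_root ur; apply/forall_inP=> v /to_root vr.
  by apply: connect_trans ur _; rewrite (sym_connect_sym adj_sym).
(* The depth passes from starts to vertices, as a vertex has only one start; 0 is a default
   elsewhere. *)
have /fin_all_exists[D DP] v : exists m, forall x,
    b x.1 x.2 = x.2 -> vertex_of w x = v -> d x = m.
  have [x /andP[/eqP bx /eqP xv]|no_x] :=
      pickP [pred x | (b x.1 x.2 == x.2) && (vertex_of w x == v)].
    by exists (d x) => x' bx' x'v; congr d; apply: (@vertex_of_inj w); rewrite ?xv.
  by exists 0 => x bx xv; have := no_x x; rewrite /= bx xv !eqxx.
apply: (@depth_acyclic _ _ _ _ D) => [e|e e'].
  case/start_edgesP=> t [q [bq q'r ->]]; rewrite edge_dst_step.
  rewrite -(DP _ _ (step_fix w (t, q)) erefl).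
  by rewrite -(DP _ (t, q) bq erefl) (dS (t, q)).
case/start_edgesP=> t [q [bq _ ->]]; case/start_edgesP=> t' [q' [bq' _ ->]] /=.
by move/(@vertex_of_inj w (t, q) (t', q') bq bq') => -[-> ->].
Qed.

Hypothesis t0_last : t0.+1 = k.

Definition encode y : vltr_data n p :=
  VltrData (cperm y.1) (y.1 t0 y.2)
    [ffun t => [ffun i => y.1 t @: porbit (rho t) (start i)]] (start_edges y).

Lemma vlab_encode y t i :
  vlab (encode y) t i = porbit (cperm y.1 t) (y.1 t (start i)).
Proof. by rewrite /= !ffunE porbit_conj. Qed.

(** Relabelling hyperedges leaves positions alone, so it acts on codes by composing every word with
    [s]. *)
Lemma relabel_encode s y :
  relabel s (encode y) = encode ([ffun t => y.1 t * s]%g, y.2).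
Proof.
rewrite /relabel /encode /=; congr VltrData.
- by apply/ffunP=> t; rewrite !ffunE conjgM.
- by rewrite ffunE permM.
- apply/ffunP=> t; apply/ffunP=> i; rewrite !ffunE -imset_comp.
  by apply: eq_imset => q; rewrite /= permM.
apply/setP=> -[t h]; apply/imsetP/idP=> [[e eA [-> ->]]|].
  have [t' [q [bq qr ->]]] := start_edgesP eA.
  by rewrite inE /= ffunE -(permM (y.1 t') s) permK bq eqxx.
rewrite inE /= ffunE invMg permM => hA; exists (t, (s^-1)%g h); last by rewrite permKV.
by rewrite inE.
Qed.

Lemma rooted_tree_mul s w r :
  rooted_tree t0 b ([ffun t => w t * s]%g, r) = rooted_tree t0 b (w, r).
Proof.
rewrite /rooted_tree; congr (_ && _); apply: eq_reaches_all => x.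
by rewrite /step /= !ffunE permM invMg permM permK.
Qed.

Lemma encode_is_vltr y : rooted_tree t0 b y -> is_vltr (encode y).
Proof.
case: y => w r tr; have /andP[/= /eqP br /reaches_allP reach] := tr.
apply/and3P; split=> /=.
- rewrite /is_constellation; set G := (<<_>>%g).
  apply/imsetP; exists (w t0 r) => //; apply/eqP.
  rewrite eq_sym -subTset; apply/subsetP=> h _.
  have orbG t h1 h2 : h1 \in porbit (cperm w t) h2 -> h1 \in orbit 'P G h2.
    case/porbitP=> m ->; apply: mem_orbit; apply/groupX/mem_gen.
    exact: imset_f.
  (* The hyperedges at [x] and at [step b w x] lie around a common vertex, so the walk to the root
     stays in one orbit. *)
  have reach_orb x m :
      iter m (step b w) x = (t0, r) -> w x.1 x.2 \in orbit 'P G (w t0 r).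
    elim: m x => [x /= ->|m IHm [t q]]; first exact: orbit_refl.
    rewrite iterSr => /IHm; apply: orbit_trans; rewrite orbit_sym /=.
    apply: (orbG (ordS t)); rewrite -{2}[w t q](permKV (w (ordS t))).
    by rewrite porbit_cperm b_id.
  have := reach_orb (t0, (w t0)^-1%g h) _ (iter_findex (reach _)).
  by rewrite permKV.
- apply/forallP=> t; apply/andP; split.
    apply/injectiveP=> i j; rewrite !vlab_encode => /eqP.
    rewrite eq_porbit_mem porbit_cperm !start_fix => /eqP; exact: start_inj.
  apply/eqP/setP=> B; apply/imsetP/imsetP=> [[i _ ->]|[h _ ->]].
    by rewrite vlab_encode; exists (w t (start i)).
  have [i iq] := start_onto t ((w t)^-1%g h); exists i => //.
  rewrite vlab_encode; apply/eqP; rewrite eq_porbit_mem -{1}[h](permKV (w t)).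
  by rewrite porbit_cperm iq b_id.
apply/existsP; exists t0; rewrite t0_last eqxx /=.
exact: rooted_tree_arborescence tr.
Qed.

(** The labels locate each block, the tree edge or root hyperedge fixes the hyperedge at its start,
    and the cyclic order fixes the rest. *)
Lemma encode_inj y y' : b t0 y.2 = y.2 -> b t0 y'.2 = y'.2 ->
  encode y = encode y' -> y = y'.
Proof.
case: y y' => w r [w' r'] /= br br' e.
have e_perms t : (rho t ^ w t = rho t ^ w' t)%g.
  by have := congr1 (fun z : vltr_data n p => perms z t) e; rewrite /= !ffunE.
have e_root : w t0 r = w' t0 r' := congr1 (@root_hyperedge _ _ _) e.
have e_edges : start_edges (w, r) = start_edges (w', r') :=
  congr1 (@arborescence _ _ _) e.
have e_vlab t (i : 'I_(p t)) :
    w t @: porbit (rho t) (start i) = w' t @: porbit (rho t) (start i).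
  by have := congr1 (fun z : vltr_data n p => vlab z t i) e; rewrite /= !ffunE.
have rr' : r = r'.
  have [i ir] := start_onto t0 r; rewrite br in ir.
  have : w' t0 r' \in w' t0 @: porbit (rho t0) (start i).
    by rewrite -e_vlab -e_root ir imset_f // porbit_id.
  by rewrite mem_imset ?porbit_rho ?br' ?start_fix ?ir => [/eqP->|]; last exact: perm_inj.
subst r'; congr (_, _); apply/ffunP=> t; apply/permP=> q.
have e_start (i : 'I_(p t)) : w t (start i) = w' t (start i).
  have [[et ei]|/eqP neq] := ((t, start i) =P (t0, r)).
    by rewrite ei; move: (et) => ->.
  have: (t, w t (start i)) \in start_edges (w, r).
    by rewrite (mem_start_edges (w, r)) start_fix eqxx.
  rewrite e_edges => /start_edgesP[t' [q' [bq' _ [et eq]]]].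
  move: eq bq'; rewrite -{}et /= => eq bq'; rewrite eq.
  have : w' t q' \in w' t @: porbit (rho t) (start i).
    by rewrite -eq -e_vlab imset_f // porbit_id.
  by rewrite mem_imset ?porbit_rho ?bq' ?start_fix => [/eqP->|]; last exact: perm_inj.
have [i iq] := start_onto t q.
have : q \in porbit (rho t) (start i) by rewrite porbit_rho iq b_id.
by case/porbitP=> m ->; rewrite -[w t _]permJ -[w' t _]permJ !conjXg e_start e_perms.
Qed.

Lemma encode_onto (x : vltr_data n p) :
    is_vltr x ->
    (forall t i, #|vlab x t i| = #|porbit (rho t) (start i)|) ->
  exists2 y, rooted_tree t0 b y & x = encode y.
Proof.
case: x => pi r V A /and3P[/= _ /forallP labP /existsP[t0']].
case/andP=> /eqP t0'_last arb cardV.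
have t00 : t0' = t0 by apply/val_inj/succn_inj; rewrite t0'_last.
subst t0'.
have V_inj t : injective (V t) by have /andP[/injectiveP] := labP t.
have VE t : [set V t i | i : 'I_(p t)] = porbits (pi t) by have /andP[_ /eqP] := labP t.
have [/andP[_ acy] /forall_inP outP] := andP arb.
have src_inc t h v : v.1 = t -> incident pi (t, h) v = (v == vertex_at pi t h).
  move=> vt; rewrite /incident [v == edge_dst _ _](_ : _ = false) ?orbF //.
  by apply/eqP=> e; move: vt; rewrite e => /eqP; rewrite (negPf (ordS_neq _ k_gt1)).
have out1 v : v \in vertices pi -> v != vertex_at pi t0 r ->
    exists h, [/\ (v.1, h) \in A, vertex_at pi v.1 h = v &
      forall h', (v.1, h') \in A -> vertex_at pi v.1 h' = v -> h' = h].
  move=> vV v'r; have /cards1P[[t h] eA] := implyP (outP v vV) v'r.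
  have : (t, h) \in [set (t, h)] by rewrite set11.
  rewrite -eA inE => /and3P[hA /= /eqP et]; rewrite src_inc // => /eqP vh.
  subst t; exists h; split=> // h' h'A vh'.
  have : (v.1, h') \in [set (v.1, h)] by rewrite -eA inE h'A /= src_inc // vh' !eqxx.
  by rewrite inE => /eqP[].
(* An edge of [A] leaving the root vertex would give every vertex an outgoing edge, hence a
   cycle. *)
have root_out h : h \in porbit (pi t0) r -> (t0, h) \notin A.
  move=> hr; apply: contraTN acy => hA.
  apply: (out_edges_not_acyclic (vertex_at_vertices pi t0 r)) => v vV.
  have [->|/(out1 v vV)[h' [h'A vh' _]]] := eqVneq v (vertex_at pi t0 r).
    exists (t0, h); split; rewrite ?vertex_at_vertices //.
    by apply/eqP; rewrite eq_vertex_at eqxx.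
  by exists (v.1, h'); rewrite vertex_at_vertices.
(* The word of type [t] is read along [pi t], from the tree edge at a non-root vertex and from [r]
   at the root vertex. *)
have conjP t : exists w : 'S_n, pi t = (rho t ^ w)%g /\
    forall i, [/\ w (start i) \in V t i,
      vertex_at pi t (w (start i)) != vertex_at pi t0 r ->
        forall h, h \in V t i -> (t, h) \in A -> h = w (start i),
      vertex_at pi t (w (start i)) != vertex_at pi t0 r ->
        (t, w (start i)) \in A &
      vertex_at pi t (w (start i)) = vertex_at pi t0 r -> w (start i) = r].
  have /fin_all_exists[s0 s0P] (i : 'I_(p t)) : exists h,
      [/\ h \in V t i,
      vertex_at pi t h != vertex_at pi t0 r ->
        forall h', h' \in V t i -> (t, h') \in A -> h' = h,
      vertex_at pi t h != vertex_at pi t0 r -> (t, h) \in A &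
      vertex_at pi t h = vertex_at pi t0 r -> h = r].
    have : V t i \in porbits (pi t) by rewrite -VE imset_f.
    case/imsetP=> h _ Vh; have [e|v'r] := eqVneq (vertex_at pi t h) (vertex_at pi t0 r).
      have [et _] := e; subst t; exists r; rewrite eqxx; split=> //.
      by rewrite Vh -eq_porbit_mem; case: e => ->.
    have [h' [/= h'A vh' h'_uniq]] := out1 _ (vertex_at_vertices pi t h) v'r.
    exists h'; rewrite vh' v'r; split=> //.
    - by rewrite Vh -eq_porbit_mem; case: vh' => ->.
    - move=> _ h2; rewrite Vh -eq_porbit_mem => /eqP h2h h2A.
      by apply: h'_uniq => //; rewrite /vertex_at h2h.
    by move/eqP; rewrite (negPf v'r).
  have /fin_all_exists[idx idxP] := @start_onto t.
  have s0V i : porbit (pi t) (s0 i) = V t i.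
    have : V t i \in porbits (pi t) by rewrite -VE imset_f.
    case/imsetP=> h _ Vh; have [+ _ _ _] := s0P i; rewrite Vh => s0h.
    by apply/eqP; rewrite eq_porbit_mem.
  have idx_start i : idx (start i) = i by apply: start_inj; rewrite idxP start_fix.
  have card_s q : b t q = q -> #|porbit (rho t) q| = #|porbit (pi t) (s0 (idx q))|.
    by move=> bq; rewrite s0V cardV idxP bq.
  have s_sep q q' : b t q = q -> b t q' = q' ->
      s0 (idx q') \in porbit (pi t) (s0 (idx q)) -> q' = q.
    move=> bq bq'; rewrite -eq_porbit_mem !s0V => /eqP/V_inj e.
    by rewrite -bq -bq' -!idxP e.
  have [w [piE wP]] := conj_perm_exists (b_id t) (@porbit_rho t) card_s s_sep.
  exists w; split=> // i; rewrite wP ?start_fix //= idx_start; exact: s0P.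
have [w wP] := fin_all_exists conjP.
have VwE t i : V t i = porbit (pi t) (w t (start i)).
  have : V t i \in porbits (pi t) by rewrite -VE imset_f.
  case/imsetP=> h _ Vh; have [_ /(_ i)[+ _ _ _]] := wP t; rewrite Vh => wh.
  by apply/esym/eqP; rewrite eq_porbit_mem.
have piE : pi = cperm [ffun t => w t].
  by apply/ffunP=> t; rewrite !ffunE; have [-> _] := wP t.
have [i0 i0r] : exists i0 : 'I_(p t0), w t0 (start i0) = r.
  have : porbit (pi t0) r \in [set V t0 i | i : 'I_(p t0)] by rewrite VE imset_f.
  case/imsetP=> i _ ri; exists i; have [_ /(_ i)[_ _ _]] := wP t0; apply.
  by rewrite /vertex_at -VwE -ri.
have vr t (i : 'I_(p t)) :
    (vertex_at pi t (w t (start i)) == vertex_at pi t0 r) =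
    ((t, start i) == (t0, start i0)).
  apply/eqP/eqP=> [e|[et ei]].
    have [et _] := e; subst t; congr (_, start _); apply: V_inj.
    by rewrite !VwE i0r; case: e.
  by move: i ei; rewrite et => i ->; rewrite i0r.
have AE : A = start_edges ([ffun t => w t], start i0).
  apply/setP=> -[t h]; rewrite inE /= ffunE; set q := (w t)^-1%g h.
  have hE : h = w t q by rewrite permKV.
  have [i iq] := start_onto t q; have [_ /(_ i)[_ uniq_i inA_i _]] := wP t.
  have hV : h \in V t i.
    rewrite VwE piE ffunE hE; have := porbit_cperm [ffun t => w t] t q (start i).
    by rewrite !ffunE porbit_sym => ->; rewrite start_fix iq.
  have [e|neq] := eqVneq (vertex_at pi t (w t (start i))) (vertex_at pi t0 r).
    have [et ei] := e; subst t; rewrite (negPf (root_out _ _)); last first.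
      by move: hV; rewrite VwE ei.
    apply/esym/negP=> /andP[/eqP bq /negP]; apply; rewrite -bq -iq -vr; exact/eqP.
  apply/idP/andP=> [hA|[/eqP bq _]]; last by rewrite hE -bq -iq inA_i.
  have qi : q = start i by apply: (@perm_inj _ (w t)); rewrite -hE; apply: uniq_i.
  by rewrite -iq qi eqxx -vr.
have xE : VltrData pi r V A = encode ([ffun t => w t], start i0).
  rewrite /encode -piE -AE /= ffunE i0r; congr VltrData.
  apply/ffunP=> t; apply/ffunP=> i; by rewrite VwE piE !ffunE porbit_conj.
exists ([ffun t => w t], start i0) => //.
by apply: acyclic_rooted_tree; rewrite /= ?start_fix // -piE -AE.
Qed.

End Encoding.

(** * Normalized codes and isomorphism classes *)

(** Right multiplication of all words by a permutation acts freely on the trees, and each orbit has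
    exactly one member whose word of type [t0] is the identity. *)
Lemma card_rooted_trees_normalized k n (t0 : 'I_k) (b : 'I_k -> 'I_n -> 'I_n) :
  #|rooted_trees t0 b| =
    #|{perm 'I_n}| * #|[set y in rooted_trees t0 b | y.1 t0 == 1%g]|.
Proof.
set T0 := [set y in _ | _].
pose act (c : 'S_n * ({ffun 'I_k -> 'S_n} * 'I_n)) :=
  ([ffun t => c.2.1 t * c.1]%g, c.2.2).
have act_inj : {in setX setT T0 &, injective act}.
  move=> [s [w r]] [s' [w' r']]; rewrite /T0 !inE /=.
  move=> /andP[_ /eqP w1] /andP[_ /eqP w1'] [/ffunP e <-].
  have es : s = s' by have := e t0; rewrite !ffunE /= w1 w1' !mul1g.
  subst s'; congr (_, (_, _)); apply/ffunP=> t.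
  by have := e t; rewrite !ffunE /= => /mulIg.
have -> : rooted_trees t0 b = act @: setX setT T0.
  apply/setP=> -[w r]; rewrite in_rooted_trees; apply/idP/imsetP.
    move=> tr; exists (w t0, ([ffun t => w t * (w t0)^-1]%g, r)).
      rewrite /T0 in_setX in_setT in_set in_rooted_trees rooted_tree_mul tr /=.
      by rewrite ffunE mulgV.
    rewrite /act /=; congr (_, _); apply/ffunP=> t.
    by rewrite !ffunE mulgKV.
  case=> -[s [w' r']]; rewrite /T0 in_setX in_set in_rooted_trees.
  by case/and3P=> _ tr _ [-> ->]; rewrite rooted_tree_mul.
by rewrite card_in_imset // cardsX cardsT.
Qed.

(** Isomorphism becomes right multiplication of codes, so each class has a unique normalized
    code. *)
Lemma card_tree_rooted k n (t0 : 'I_k) (gamma : 'I_k -> seq nat)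
    (b : 'I_k -> 'I_n -> 'I_n) (rho : 'I_k -> 'S_n)
    (start : forall t, 'I_(size (gamma t)) -> 'I_n) :
    2 <= k -> t0.+1 = k -> idempotent_blocks b ->
    (forall t q q', (q' \in porbit (rho t) q) = (b t q' == b t q)) ->
    (forall t (i : 'I_(size (gamma t))), b t (start t i) = start t i) ->
    (forall t q, exists i : 'I_(size (gamma t)), start t i = b t q) ->
    (forall t, injective (start t)) ->
    (forall t i, #|porbit (rho t) (start t i)| = nth 0 (gamma t) i) ->
  #|tree_rooted n gamma| = #|[set y in rooted_trees t0 b | y.1 t0 == 1%g]|.
Proof.
move=> k_gt1 t0_last b_id porbit_rho start_fix start_onto start_inj card_rho.
set T0 := [set y in _ | _]; pose enc := encode t0 b rho start.
have relabel_enc s y : relabel s (enc y) = enc ([ffun t => y.1 t * s]%g, y.2).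
  exact: relabel_encode.
rewrite card_sig; pose cls y := iso_class (enc y).
have cls_mul s (y : {ffun 'I_k -> 'S_n} * 'I_n) :
    cls ([ffun t => y.1 t * s]%g, y.2) = cls y.
  apply/setP=> z; apply/imsetP/imsetP=> -[u _ ->].
    exists (s * u)%g => //; rewrite !relabel_enc /=; congr (enc (_, _)).
    by apply/ffunP=> t; rewrite !ffunE mulgA.
  exists (s^-1 * u)%g => //; rewrite !relabel_enc /=; congr (enc (_, _)).
  by apply/ffunP=> t; rewrite !ffunE mulgA mulgK.
have cls_inj : {in T0 &, injective cls}.
  move=> [w r] [w' r']; rewrite /T0 !inE /= => /andP[/andP[/eqP br _] /eqP w1].
  move=> /andP[/andP[/eqP br' _] /eqP w1'] e.
  have : enc (w', r') \in cls (w, r).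
    rewrite e; apply/imsetP; exists 1%g => //; rewrite relabel_enc /=.
    by congr (enc (_, _)); apply/ffunP=> t; rewrite ffunE mulg1.
  case/imsetP=> s _; rewrite relabel_enc.
  move/(encode_inj b_id porbit_rho start_fix start_onto) => /= /(_ br' br)[ew ->].
  have s1 : s = 1%g by move: w1'; rewrite ew ffunE w1 mul1g.
  by congr (_, _); rewrite ew s1; apply/ffunP=> t; rewrite ffunE mulg1.
rewrite -(card_in_imset cls_inj); apply: eq_card => c.
apply/imsetP/imsetP=> [[x]|[y]].
  rewrite inE => /andP[x_vltr /forallP x_comp] ->.
  have card_x t i : #|vlab x t i| = #|porbit (rho t) (start t i)|.
    by rewrite card_rho; have /forallP/(_ i)/eqP := x_comp t.
  have [[w r] tr ->] := encode_onto k_gt1 b_id porbit_rho start_fix start_onto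
                          start_inj t0_last x_vltr card_x.
  exists ([ffun t => w t * (w t0)^-1]%g, r).
    by rewrite /T0 in_set in_rooted_trees rooted_tree_mul tr /= ffunE mulgV.
  by rewrite (cls_mul _ (w, r)).
rewrite /T0 in_set in_rooted_trees => /andP[tr _] ->; exists (enc y) => //.
rewrite inE; apply/andP; split; first exact: encode_is_vltr.
apply/forallP=> t; apply/forallP=> i; rewrite -card_rho /hyperdegree /=.
by rewrite !ffunE card_imset //; apply: perm_inj.
Qed.

(** * Block structures of compositions *)

Lemma composition_blocks n s : is_composition n s ->
  exists b : 'I_n -> 'I_n,
    [/\ size s <= n, forall q, b (b q) = b q, forall q, (b q == q) = (q < size s)
      & forall i : 'I_n, i < size s -> #|[pred q | b q == i]| = nth 0 s i].
Proof.
case/andP=> /all_nthP/= s_pos /eqP sum_s; set p := size s.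
have pos i : i < p -> 0 < nth 0 s i by apply: s_pos.
(* The starts come first; then each block [i] receives its remaining positions, one fewer than its
   part. Hence the starts depend only on the length of [s]. *)
pose L := iota 0 p ++ flatten [seq nseq (nth 0 s i).-1 i | i <- iota 0 p].
have size_L : size L = n.
  rewrite size_cat -sum1_size size_flatten /shape -map_comp sumnE big_map.
  rewrite -big_split /= -sum_s sumnE [RHS](big_nth 0) /index_iota subn0.
  apply: eq_big_seq => i.
  by rewrite mem_iota => /pos i_pos; rewrite size_nseq add1n prednK.
have p_le : p <= n by rewrite -size_L size_cat size_iota leq_addr.
have L_lt q : q < n -> nth 0 L q < p.
  rewrite -size_L => /(mem_nth 0); rewrite mem_cat mem_iota => /orP[//|].
  case/flattenP=> _ /mapP[i + ->] /nseqP[-> _]; by rewrite mem_iota.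
pose b (q : 'I_n) := Ordinal (leq_trans (L_lt q (ltn_ord q)) p_le).
have b_lt (q : 'I_n) : q < p -> b q = q :> nat.
  by move=> ltq; rewrite /= nth_cat size_iota ltq nth_iota.
exists b; split=> // [q|q|i ip].
- by apply/val_inj/b_lt/L_lt/ltn_ord.
- apply/eqP/idP=> [<-|ltq]; first exact: (L_lt q).
  by apply/val_inj/b_lt.
have -> : #|[pred q | b q == i]| = count_mem (val i) L.
  rewrite -sum1_card -sum1_count (big_nth 0) size_L big_mkord.
  by apply: eq_bigl => q; rewrite inE -val_eqE.
rewrite count_cat count_uniq_mem ?iota_uniq // mem_iota /= add0n ip.
rewrite count_flatten -map_comp sumnE big_map.
rewrite (bigD1_seq (val i)) ?iota_uniq ?mem_iota //=.
rewrite count_nseq /= eqxx mul1n big1 ?addn0 ?add1n ?prednK ?pos // => j ji.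
by rewrite count_nseq /= (negPf ji).
Qed.

Lemma blocks_of_compositions k n (gamma : 'I_k -> seq nat) :
    (forall t, is_composition n (gamma t)) ->
  exists (b : 'I_k -> 'I_n -> 'I_n),
    [/\ idempotent_blocks b,
      forall t q, (b t q == q) = (q < size (gamma t))
    & forall t0 : 'I_k, 2 <= k -> t0.+1 = k ->
      #|tree_rooted n gamma| = #|[set y in rooted_trees t0 b | y.1 t0 == 1%g]|].
Proof.
move=> comp; have /fin_all_exists[b bP] t := composition_blocks (comp t).
have /fin_all_exists[rho rhoP] t := perm_of_blocks (b t).
have b_id : idempotent_blocks b by move=> t q; have [_ + _ _] := bP t.
have b_fix t q : (b t q == q) = (q < size (gamma t)) by have [_ _ + _] := bP t.
exists b; split=> // t0 k_gt1 t0_last.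
have size_le t : size (gamma t) <= n.
  by have [+ _ _ _] := bP t.
pose start t := widen_ord (size_le t).
have start_fix t i : b t (start t i) = start t i.
  by apply/eqP; rewrite b_fix /= ltn_ord.
apply: (@card_tree_rooted _ _ _ _ b rho start) => // [t q|t i j|t i].
- have lt_bq : b t q < size (gamma t) by rewrite -b_fix b_id.
  by exists (Ordinal lt_bq); apply: val_inj.
- by move/(congr1 val) => /= /val_inj.
have [_ _ _ /(_ (start t i) (ltn_ord i)) /= <-] := bP t.
by apply: eq_card => q; rewrite rhoP start_fix.
Qed.

Theorem theorem4p1 (k n : nat) (hk : 2 <= k) (hn : 1 <= n)
    (gamma delta : 'I_k -> seq nat)
    (hgamma : forall t : 'I_k, is_composition n (gamma t))
    (hdelta : forall t : 'I_k, is_composition n (delta t))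
    (hlen : forall t : 'I_k, size (gamma t) = size (delta t)) :
  exists f : tree_rooted n gamma -> tree_rooted n delta, bijective f.
Proof.
apply: card_bij.
have [b [b_id b_fix b_card]] := blocks_of_compositions hgamma.
have [b' [b'_id b'_fix b'_card]] := blocks_of_compositions hdelta.
have k_gt0 : k.-1 < k by rewrite prednK // ltnW.
pose t0 := Ordinal k_gt0; have t0_last : t0.+1 = k by rewrite prednK // ltnW.
rewrite (b_card t0) // (b'_card t0) //.
have Sn_gt0 : 0 < #|{perm 'I_n}| by apply/card_gt0P; exists 1%g.
(* The exchange may alter the word of type [t0] and so break normalization; the comparison is
   therefore made on all trees, after multiplying by n!. *)
apply/eqP; rewrite -(eqn_pmul2l Sn_gt0) -!card_rooted_trees_normalized.
apply/eqP/(card_rooted_trees_eq _ hk) => // t q.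
by rewrite b_fix b'_fix hlen.
Qed.
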